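(* Let $\bar A$ specify a random graph with independent edges satisfying $(\epsilon,\delta)$-concentration for some $\epsilon,\delta\in(0,1)$, and let $\beta>0$ and $b\in\mathbb{R}^n_{\ge0}$. Then with probability at least $1-\delta$ over the draw of $A$ from $\bar A$, the following holds: if the spectral radius of $A$ is less than $1/\beta$, then there is $C_0$ such that for every budget $C\ge C_0$ the intervention $y=\sqrt C\,v_1(\bar A)$ has competitive ratio $W(y)/W(y^* )\ge1-\epsilon$ in the network game on $A$.
   Context: Random graph with independent edges: given a symmetric $\bar A\in[0,1]^{n\times n}$, a graph with adjacency matrix $A$ is sampled by including each edge $\{i,j\}$ independently with probability $\bar A_{ij}$. $v_1(\bar A)$ is the unit eigenvector for the largest eigenvalue $\lambda_1(\bar A)$, with the sign chosen to have nonnegative entries. The inverted spectral gap of $\bar A$ is the smallest $\kappa$ with $|\lambda_i(\bar A)|\le\kappa\lambda_1(\bar A)$ for all $i>1$. $\bar A$ satisfies $(\epsilon,\delta)$-concentration if: (1) the maximum expected degree $d_{\max}=\max_i\sum_j\bar A_{ij}$ is at least $\frac49\log(2n/\delta)$; (2) the inverted spectral gap of $\bar A$ is at most $\kappa$ for some $\kappa<1$; (3) $\lambda_1(\bar A)(1-\kappa^2)\ge\frac{1024\sqrt{d_{\max}\log(2n/\delta)}}{\epsilon^2}$. Network game: agent $i$ has utility $u_i(a)=b_ia_i-\tfrac12a_i^2+\beta\sum_jA_{ij}a_ia_j$; $M=I-\beta A$; an intervention $y$ replaces $b$ by $b+y$ and yields equilibrium welfare $W(y)=\tfrac12\|M^{-1}(b+y)\|^2$;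 the optimal intervention of budget $C$ is $y^*\in\arg\max_{\|x\|=\sqrt C}W(x)$; the competitive ratio of $y$ is $W(y)/W(y^* )$. *)

(* Defs.v *)
From HB Require Import structures.
From mathcomp Require Import all_boot all_order all_algebra.
From mathcomp Require Import boolp reals exp.
Set Implicit Arguments. Unset Strict Implicit. Unset Printing Implicit Defensive.
Import Order.TTheory GRing.Theory Num.Theory.
Local Open Scope ring_scope.

Section Defs.
Variable R : realType.
Variable n : nat.

Definition sqnorm (v : 'cV[R]_n) : R := \sum_i (v i 0) ^+ 2.
Definition vnorm (v : 'cV[R]_n) : R := Num.sqrt (sqnorm v).

Definition edge_prob_matrix (Abar : 'M[R]_n) : Prop :=
  Abar^T = Abar /\ forall i j, 0 <= Abar i j <= 1.

(* Outcomes of the random graph: one bit per ordered pair; only pairs (i,j)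
   with i <= j are random, the others are forced to false (weight 0). *)
Definition outcome := {ffun 'I_n * 'I_n -> bool}.

Definition outcome_weight (Abar : 'M[R]_n) (w : outcome) : R :=
  \prod_(p : 'I_n * 'I_n)
    (if (p.1 <= p.2)%N then (if w p then Abar p.1 p.2 else 1 - Abar p.1 p.2)
     else (if w p then 0 else 1)).

Definition adjmx (w : outcome) : 'M[R]_n :=
  \matrix_(i, j) (if w (if (i <= j)%N then (i, j) else (j, i)) then 1 else 0).

Definition prob_graph (Abar : 'M[R]_n) (E : 'M[R]_n -> Prop) : R :=
  \sum_(w : outcome | `[< E (adjmx w) >]) outcome_weight Abar w.

Definition dmax (Abar : 'M[R]_n) : R := \big[Num.max/0]_i \sum_j Abar i j.

Definition top_eigenpair (Abar : 'M[R]_n) (lam1 : R) (v1 : 'cV[R]_n) : Prop :=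
  Abar *m v1 = lam1 *: v1 /\ vnorm v1 = 1 /\ (forall i, 0 <= v1 i 0) /\
  (forall (mu : R) (v : 'cV[R]_n), v != 0 -> Abar *m v = mu *: v -> mu <= lam1).

(* the inverted spectral gap of Abar is at most kappa: writing the eigenvalues
   (with multiplicity) as lam1 = lambda_1, lambda_2, ..., lambda_n, one has
   |lambda_i| <= kappa * lam1 for all i > 1 *)
Definition inv_spectral_gap_le (Abar : 'M[R]_n) (lam1 kappa : R) : Prop :=
  exists s : seq R,
    char_poly Abar = \prod_(x <- lam1 :: s) ('X - x%:P) /\
    (forall x, x \in s -> `|x| <= kappa * lam1).

Definition concentration (Abar : 'M[R]_n) (lam1 eps delta : R) : Prop :=
  dmax Abar >= 4 / 9 * ln (2 * n%:R / delta) /\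
  exists kappa : R, 0 <= kappa /\ kappa < 1 /\
    inv_spectral_gap_le Abar lam1 kappa /\
    lam1 * (1 - kappa ^+ 2) >=
      1024 * Num.sqrt (dmax Abar * ln (2 * n%:R / delta)) / eps ^+ 2.

(* spectral radius of A is less than r (A symmetric: all eigenvalues real) *)
Definition spectral_radius_lt (A : 'M[R]_n) (r : R) : Prop :=
  forall (mu : R) (v : 'cV[R]_n), v != 0 -> A *m v = mu *: v -> `|mu| < r.

Definition Mgame (beta : R) (A : 'M[R]_n) : 'M[R]_n := 1%:M - beta *: A.

Definition welfare (beta : R) (A : 'M[R]_n) (b y : 'cV[R]_n) : R :=
  1 / 2 * sqnorm (invmx (Mgame beta A) *m (b + y)).

Definition optimal_intervention (beta : R) (A : 'M[R]_n) (b : 'cV[R]_n)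
    (C : R) (ystar : 'cV[R]_n) : Prop :=
  vnorm ystar = Num.sqrt C /\
  forall x : 'cV[R]_n, vnorm x = Num.sqrt C ->
    welfare beta A b x <= welfare beta A b ystar.

Definition competitive_ratio (beta : R) (A : 'M[R]_n) (b y ystar : 'cV[R]_n) : R :=
  welfare beta A b y / welfare beta A b ystar.

End Defs.

(* Main.v *)
Require Import Defs.
From HB Require Import structures.
From mathcomp Require Import all_boot all_order all_algebra.
From mathcomp Require Import ring lra.
From mathcomp Require Import boolp classical_sets reals topology normedtype.
From mathcomp Require Import sequences derive exp.
Set Implicit Arguments. Unset Strict Implicit. Unset Printing Implicit Defensive.
Import Order.TTheory GRing.Theory Num.Theory numFieldNormedType.Exports.
Local Open Scope ring_scope.

(** The trace moment method bounds [B = A - Abar].  In the expansion of [B ^+ m] the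
    mean of a product of centred edge variables vanishes as soon as one edge occurs
    exactly once; for [r >= 1], an edge of probability [p] visited [k >= 2] times
    contributes at most [r ^+ k * (p / r ^+ 2)].  Extending a walk by one step hence
    costs a factor [r * (m + d / r ^+ 2)], for at most [m] old edges and new edges of
    total weight [d / r ^+ 2], and
      [E (tr (B ^+ m)) <= n * (m * r + d / r) ^+ m].
    With [L = ln (2 * n / delta)], [r] of order [sqrt (d / L)] and [m] a power of two
    of order [L], Markov's inequality gives [|x^T B x| <= 14 * sqrt (d * L)] for all
    unit [x] with probability at least [1 - delta].  Comparing Rayleigh quotients, the
    top eigenvector [u] of [A] then satisfies [1 - <u, v1> ^+ 2 < eps].  Finally
    [|M^-1 x|] lies between [|<u, x>| / (1 - beta * mu)] and
    [|x| / (1 - beta * mu)], so the competitive ratio is bounded below by a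
    quantity tending to [<u, v1> ^+ 2] as the budget grows. *)

(** * Euclidean vectors and quadratic forms *)

Section DotProduct.
Variables (R : comNzRingType) (n : nat).
Implicit Types u v : 'cV[R]_n.

Definition dotv u v : R := (u^T *m v) 0 0.

Fact dotv_is_bilinear :
  bilinear_for (GRing.Scale.Law.clone _ _ *%R _)
    (GRing.Scale.Law.clone _ _ *%R _) dotv.
Proof.
split=> [v|u] a x y /=; rewrite /dotv.
- by rewrite linearP /= mulmxDl -scalemxAl !mxE.
- by rewrite mulmxDr -scalemxAr !mxE.
Qed.

HB.instance Definition _ := bilinear_isBilinear.Build R 'cV[R]_n 'cV[R]_n R
  *%R *%R dotv dotv_is_bilinear.

Lemma dotvE u v : dotv u v = \sum_i u i 0 * v i 0.
Proof. by rewrite /dotv mxE; apply: eq_bigr => i _; rewrite mxE. Qed.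

Lemma dotvC u v : dotv u v = dotv v u.
Proof. by rewrite !dotvE; apply: eq_bigr => i _; rewrite mulrC. Qed.

End DotProduct.

Lemma dotv_mulmx (R : comNzRingType) m n (A : 'M[R]_(m, n)) u v :
  dotv u (A *m v) = dotv (A^T *m u) v.
Proof. by rewrite /dotv trmx_mul trmxK mulmxA. Qed.

Section EuclideanNorm.
Variables (R : realType) (n : nat).
Implicit Types (u v : 'cV[R]_n) (a : R).

Lemma dotvv u : dotv u u = sqnorm u.
Proof. by rewrite dotvE; apply: eq_bigr => i _; rewrite expr2. Qed.

Lemma sqnorm_ge0 u : 0 <= sqnorm u.
Proof. by apply: sumr_ge0 => i _; rewrite sqr_ge0. Qed.

Lemma sqnorm0 : sqnorm (0 : 'cV[R]_n) = 0.
Proof. by rewrite -dotvv linear0r. Qed.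

Lemma sqnorm_eq0 u : (sqnorm u == 0) = (u == 0).
Proof.
apply/idP/eqP => [|->]; last by rewrite sqnorm0.
rewrite psumr_eq0 => [/allP u0|i _]; last exact: sqr_ge0.
apply/colP => i; apply/eqP; rewrite mxE -sqrf_eq0.
by apply: (implyP (u0 i _)); rewrite ?mem_index_enum.
Qed.

Lemma sqnorm_gt0 u : (0 < sqnorm u) = (u != 0).
Proof. by rewrite lt_def sqnorm_ge0 andbT sqnorm_eq0. Qed.

Lemma sqnormZ a u : sqnorm (a *: u) = a ^+ 2 * sqnorm u.
Proof. by rewrite -!dotvv linearZl linearZr /= mulrA expr2. Qed.

Lemma sqnormD u v : sqnorm (u + v) = sqnorm u + 2 * dotv u v + sqnorm v.
Proof. by rewrite -!dotvv linearDl !linearDr /= (dotvC v u); ring. Qed.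

Lemma vnorm_ge0 u : 0 <= vnorm u.
Proof. exact: sqrtr_ge0. Qed.

Lemma sqr_vnorm u : vnorm u ^+ 2 = sqnorm u.
Proof. by rewrite sqr_sqrtr ?sqnorm_ge0. Qed.

Lemma vnormZ a u : vnorm (a *: u) = `|a| * vnorm u.
Proof. by rewrite /vnorm sqnormZ sqrtrM ?sqr_ge0 // sqrtr_sqr. Qed.

Lemma vnorm_eq1 u : vnorm u = 1 <-> sqnorm u = 1.
Proof.
split=> [u_unit|u_unit]; first by rewrite -sqr_vnorm u_unit expr1n.
by rewrite /vnorm u_unit sqrtr1.
Qed.

End EuclideanNorm.

Section QuadraticForm.
Variables (R : realType) (n : nat).
Implicit Types (u v x y z : 'cV[R]_n) (A B : 'M[R]_n) (a : R).

Definition qform A x : R := dotv x (A *m x).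

Lemma qform1 x : qform 1%:M x = sqnorm x.
Proof. by rewrite /qform mul1mx dotvv. Qed.

Lemma qformE A x : qform A x = \sum_i x i 0 * \sum_j A i j * x j 0.
Proof. by rewrite /qform dotvE; apply: eq_bigr => i _; rewrite mxE. Qed.

Lemma qform0 A : qform A 0 = 0.
Proof. by rewrite /qform mulmx0 linear0r. Qed.

Lemma qformZ A a x : qform A (a *: x) = a ^+ 2 * qform A x.
Proof. by rewrite /qform -scalemxAr linearZl linearZr /= mulrA expr2. Qed.

Lemma qformB A B x : qform (A - B) x = qform A x - qform B x.
Proof. by rewrite /qform mulmxBl linearBr. Qed.

Lemma qform_scalar a x : qform a%:M x = a * sqnorm x.
Proof. by rewrite /qform mul_scalar_mx linearZr /= dotvv. Qed.

Lemma dotv_mulmxC A x y : A^T = A -> dotv x (A *m y) = dotv y (A *m x).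
Proof. by move=> symA; rewrite dotv_mulmx symA dotvC. Qed.

Lemma qformD A x y : A^T = A ->
  qform A (x + y) = qform A x + 2 * dotv x (A *m y) + qform A y.
Proof.
move=> symA; rewrite /qform mulmxDr linearDl !linearDr /=.
by rewrite (dotv_mulmxC y x symA); ring.
Qed.

(* The polynomial [t |-> qform A (x + t *: y)] is nonnegative, hence so is the
   opposite of its discriminant. *)
Lemma psd_cauchy_schwarz A x y : A^T = A -> (forall z, 0 <= qform A z) ->
  dotv x (A *m y) ^+ 2 <= qform A x * qform A y.
Proof.
move=> symA psdA; pose p := Poly [:: qform A x; 2 * dotv x (A *m y); qform A y].
have p_ge0 t : 0 <= p.[t].
  have -> : p.[t] = qform A (x + t *: y); last exact: psdA.
  by rewrite horner_Poly /= qformD // qformZ -scalemxAr linearZr /=; ring.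
have size_p : (size p <= 3)%N by exact: size_Poly.
have := deg_le2_poly_ge0 size_p p_ge0.
by rewrite !coef_Poly /=; nra.
Qed.

Lemma psd_qform_eq0 A u : A^T = A -> (forall z, 0 <= qform A z) ->
  qform A u = 0 -> A *m u = 0.
Proof.
move=> symA psdA formu0; apply/eqP; rewrite -sqnorm_eq0 -sqrf_eq0 eq_le sqr_ge0 andbT.
by rewrite -dotvv (le_trans (psd_cauchy_schwarz _ _ symA psdA)) // formu0 mulr0.
Qed.

Lemma cauchy_schwarz u v : dotv u v ^+ 2 <= sqnorm u * sqnorm v.
Proof.
have psd1 z : 0 <= qform 1%:M z by rewrite qform1 sqnorm_ge0.
by have := psd_cauchy_schwarz u v (@trmx1 R n) psd1; rewrite mul1mx !qform1.
Qed.

Lemma dotv_le_vnorm u v : `|dotv u v| <= vnorm u * vnorm v.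
Proof.
rewrite -(@ler_pXn2r _ 2) ?nnegrE ?mulr_ge0 ?vnorm_ge0 //.
by rewrite real_normK ?num_real // exprMn !sqr_vnorm cauchy_schwarz.
Qed.

Lemma ler_vnormD u v : vnorm (u + v) <= vnorm u + vnorm v.
Proof.
rewrite -(@ler_pXn2r _ 2) ?nnegrE ?addr_ge0 ?vnorm_ge0 //.
rewrite sqr_vnorm sqnormD -!sqr_vnorm.
by have := le_trans (ler_norm _) (dotv_le_vnorm u v); lra.
Qed.

End QuadraticForm.

Lemma unit_vector_dim_gt0 (R : realType) n (v : 'cV[R]_n) : sqnorm v = 1 -> (0 < n)%N.
Proof. by case: n v => // v /eqP; rewrite /sqnorm big_ord0 eq_sym oner_eq0. Qed.

Lemma trmx_exp (R : comNzRingType) n (A : 'M[R]_n) k : (A ^+ k)^T = A^T ^+ k.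
Proof.
elim: k => [|k IH]; first by rewrite !expr0 trmx1.
by rewrite exprSr -mulmxE trmx_mul IH mulmxE -exprS.
Qed.

Lemma sqnorm_mulmx_le (R : realType) m n (A : 'M[R]_(m, n)) u :
  sqnorm (A *m u) <= \tr (A *m A^T) * sqnorm u.
Proof.
rewrite {1}/sqnorm /mxtrace mulr_suml; apply: ler_sum => i _.
have -> : (A *m u) i 0 = dotv (row i A)^T u.
  by rewrite mxE dotvE; apply: eq_bigr => j _; rewrite !mxE.
have -> : (A *m A^T) i i = sqnorm (row i A)^T.
  by rewrite mxE; apply: eq_bigr => j _; rewrite !mxE expr2.
exact: cauchy_schwarz.
Qed.

Section PowerTrace.
Variables (R : realType) (n : nat).
Implicit Types (u : 'cV[R]_n) (A : 'M[R]_n).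

Lemma mxtrace_exp_double_ge0 A k : A^T = A -> 0 <= \tr (A ^+ k.*2).
Proof.
move=> symA; rewrite -addnn exprD -{1}symA -trmx_exp -mulmxE.
apply: sumr_ge0 => i _; rewrite mxE; apply: sumr_ge0 => j _.
by rewrite mxE -expr2 sqr_ge0.
Qed.

Lemma qform_sqr A u : A^T = A -> qform (A ^+ 2) u = sqnorm (A *m u).
Proof.
by move=> symA; rewrite /qform expr2 -mulmxE -mulmxA dotv_mulmx symA dotvv.
Qed.

Lemma qform_expn2_le A u k : A^T = A -> sqnorm u = 1 ->
  qform A u ^+ (2 ^ k) <= qform (A ^+ (2 ^ k)) u.
Proof.
move=> symA u_unit; elim: k A symA => [|k IH] A symA; first by rewrite !expr1.
have symA2 : (A ^+ 2)^T = A ^+ 2 by rewrite trmx_exp symA.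
rewrite expnS !exprM; apply: le_trans (IH _ symA2).
rewrite lerXn2r ?nnegrE ?sqr_ge0 ?qform_sqr ?sqnorm_ge0 //.
by apply: le_trans (cauchy_schwarz _ _) _; rewrite u_unit mul1r.
Qed.

Lemma qform_expn2_le_trace A u k : A^T = A -> sqnorm u = 1 ->
  qform A u ^+ (2 ^ k.+1) <= \tr (A ^+ (2 ^ k.+1)).
Proof.
move=> symA u_unit; apply: le_trans (qform_expn2_le _ symA u_unit) _.
have symAk : (A ^+ (2 ^ k))^T = A ^+ (2 ^ k) by rewrite trmx_exp symA.
rewrite expnSr exprM qform_sqr //; apply: le_trans (sqnorm_mulmx_le _ _) _.
by rewrite u_unit mulr1 symAk mulmxE -expr2.
Qed.

End PowerTrace.

(** * Principal eigenvectors of symmetric matrices *)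

Section PrincipalEigenpair.
Variables (R : realType) (n : nat).
Implicit Types (u : 'cV[R]_n) (A : 'M[R]_n) (mu : R).

Definition principal_eigenpair A mu u :=
  [/\ sqnorm u = 1, A *m u = mu *: u & forall x, qform A x <= mu * sqnorm x].

Lemma qform_continuous A : continuous (fun x : 'rV[R]_n => qform A x^T).
Proof.
have cont_coord i : continuous (fun x : 'rV[R]_n => x^T i 0).
  by under eq_fun do rewrite mxE; exact: coord_continuous.
under eq_fun do rewrite qformE.
have continuous_mul (f g : 'rV[R]_n -> R) : continuous f -> continuous g ->
    continuous (fun x => f x * g x).
  by move=> cf cg x; exact: continuousM (cf x) (cg x).
apply: (continuous_big add_continuous) => i _; apply: (continuous_mul _ _) => //.
apply: (continuous_big add_continuous) => j _; apply: (continuous_mul _ _) => // x.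
exact: cst_continuous.
Qed.

Lemma sphere_compact : compact [set x : 'rV[R]_n | sqnorm x^T = 1]%classic.
Proof.
apply: bounded_closed_compact.
  exists 1; split=> [|M M1 x /= x1]; first exact: num_real.
  rewrite [leLHS]/Num.norm /= mx_normrE.
  apply: bigmax_le => [|[i j] _ /=]; first lra.
  apply: le_trans (ltW M1); rewrite ord1 -(@expr_le1 _ 2) // real_normK ?num_real //.
  rewrite -x1 /sqnorm (bigD1 j) //= mxE lerDl.
  by apply: sumr_ge0 => k _; exact: sqr_ge0.
have -> : [set x : 'rV[R]_n | sqnorm x^T = 1]%classic
    = ((fun x : 'rV[R]_n => qform 1%:M x^T) @^-1` [set 1])%classic.
  by apply/funext => x /=; rewrite qform1.
by apply: closed_comp => [x _|]; [exact: qform_continuous | exact: closed_eq].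
Qed.

Lemma exists_qform_max A : (0 < n)%N ->
  exists2 u, sqnorm u = 1 & forall x, qform A x <= qform A u * sqnorm x.
Proof.
move=> n_gt0.
have sphere_neq0 : ([set x : 'rV[R]_n | sqnorm x^T = 1] !=set0)%classic.
  exists (delta_mx 0 (Ordinal n_gt0)).
  by rewrite /= trmx_delta -dotvv /dotv trmx_delta mul_delta_mx mxE !eqxx.
have cont_qform := continuous_subspaceT (@qform_continuous A).
have [c] := EVT_max_rV sphere_neq0 sphere_compact (cont_qform _).
rewrite inE /= => c_unit c_max; exists c^T => // x.
have [->|x0] := eqVneq x 0; first by rewrite sqnorm0 mulr0 qform0.
have sqr_inv_norm : (vnorm x)^-1 ^+ 2 = (sqnorm x)^-1 by rewrite exprVn sqr_vnorm.
have /c_max : ((vnorm x)^-1 *: x)^T \in [set x : 'rV[R]_n | sqnorm x^T = 1]%classic.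
  by rewrite inE /= trmxK sqnormZ sqr_inv_norm mulVf // sqnorm_eq0.
by rewrite trmxK qformZ sqr_inv_norm mulrC ler_pdivrMr ?sqnorm_gt0.
Qed.

(* [mu%:M - A] is positive semidefinite and its form vanishes at the maximizer. *)
Lemma exists_principal_eigenpair A : (0 < n)%N -> A^T = A ->
  exists mu u, principal_eigenpair A mu u.
Proof.
move=> n_gt0 symA; have [u u_unit le_max] := exists_qform_max A n_gt0.
exists (qform A u), u; split=> //; apply/eqP; rewrite eq_sym -subr_eq0.
rewrite -mul_scalar_mx -mulmxBl; apply/eqP; apply: psd_qform_eq0.
- by rewrite linearB /= tr_scalar_mx symA.
- by move=> x; rewrite qformB qform_scalar subr_ge0.
- by rewrite qformB qform_scalar u_unit mulr1 subrr.
Qed.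

End PrincipalEigenpair.

(** * Deflation *)

Lemma det_scalar_add_mulmxC (R : comNzRingType) m n (B : 'M[R]_(m, n))
    (C : 'M[R]_(n, m)) (a : R) :
  a ^+ n * \det (a%:M + B *m C) = a ^+ m * \det (a%:M + C *m B).
Proof.
pose M := block_mx a%:M (- B) C 1%:M.
have ME : M = block_mx 1%:M (- B) 0 1%:M *m block_mx (a%:M + B *m C) 0 C 1%:M.
  by rewrite mulmx_block !mul0mx !mul1mx !mulmx1 !add0r mulNmx addrK.
have MB : M *m block_mx 1%:M B 0 a%:M = block_mx a%:M 0 C (a%:M + C *m B).
  rewrite mulmx_block !mulmx0 !mulmx1 mul1mx !addr0 mul_mx_scalar mul_scalar_mx.
  by rewrite scalerN subrr addrC.
have := congr1 determinant MB; rewrite det_mulmx ME det_mulmx.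
by rewrite !det_lblock !det_ublock !det1 !mul1r !mulr1 !det_scalar mulrC.
Qed.

(* [v] is an eigenvector, so
   [(X - A)(X - lam + lam v w) = (X - lam)(X - A + lam v w)]. *)
Lemma char_poly_deflation (R : comNzRingType) n (A : 'M[R]_n) (lam : R)
    (v : 'cV[R]_n) (w : 'rV[R]_n) :
  A *m v = lam *: v -> w *m v = 1%:M ->
  'X * char_poly A = ('X - lam%:P) * char_poly (A - lam *: (v *m w)).
Proof.
move=> Av wv; set Xlam := 'X - lam%:P.
pose pv := map_mx polyC v; pose pw := map_mx polyC w.
have Xpv : char_poly_mx A *m pv = Xlam *: pv.
  by rewrite /char_poly_mx mulmxBl mul_scalar_mx -map_mxM Av map_mxZ /= scalerBl.
have factor : char_poly_mx A *m (Xlam%:M + (lam%:P *: pv) *m pw)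
    = Xlam *: char_poly_mx (A - lam *: (v *m w)).
  rewrite mulmxDr mul_mx_scalar mulmxA -scalemxAr Xpv scalerA mulrC -scalerA.
  rewrite -scalemxAl -scalerDr -scalemxAl -map_mxM -map_mxZ; congr (_ *: _).
  by rewrite /char_poly_mx map_mxB opprB addrA addrAC.
have detXlam : Xlam * \det (Xlam%:M + (lam%:P *: pv) *m pw) = Xlam ^+ n * 'X.
  have := det_scalar_add_mulmxC (lam%:P *: pv) pw Xlam; rewrite expr1 => ->.
  rewrite -scalemxAr -map_mxM wv map_scalar_mx /= scale_scalar_mx mulr1 -raddfD /=.
  by rewrite subrK det_scalar expr1.
have := congr1 determinant factor; rewrite det_mulmx detZ.
rewrite -/(char_poly A) -/(char_poly (_ - _)) => detE.
have Xlam_reg : GRing.lreg (Xlam ^+ n) by apply/lregX/monic_lreg/monicXsubC.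
by apply: Xlam_reg; rewrite mulrA -detXlam mulrCA -detE; ring.
Qed.

(* The top Rayleigh quotient of the deflated matrix is a root of its
   characteristic polynomial, hence [0] or one of the remaining eigenvalues. *)
Lemma qform_orthogonal_le (R : realType) n (A : 'M[R]_n) (lam kappa : R)
    (v x : 'cV[R]_n) :
  A^T = A -> sqnorm v = 1 -> A *m v = lam *: v -> 0 <= kappa * lam ->
  inv_spectral_gap_le A lam kappa -> dotv v x = 0 ->
  qform A x <= kappa * lam * sqnorm x.
Proof.
move=> symA v_unit Av klam0 [s [char_polyA gap]] vx.
pose T := A - lam *: (v *m v^T).
have symT : T^T = T by rewrite linearB linearZ /= trmx_mul trmxK symA.
have n_gt0 := unit_vector_dim_gt0 v_unit.
have [mu [u [u_unit Tu le_mu]]] := exists_principal_eigenpair n_gt0 symT.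
have <- : qform T x = qform A x.
  rewrite qformB /qform -scalemxAl linearZr -mulmxA [v^T *m x]mx11_scalar /=.
  by rewrite -/(dotv v x) vx mul_mx_scalar scale0r linear0r mulr0 subr0.
apply: le_trans (le_mu x) _; rewrite ler_wpM2r ?sqnorm_ge0 //.
have char_polyT : char_poly T = \prod_(y <- 0 :: s) ('X - y%:P).
  have vv1 : v^T *m v = 1%:M by rewrite [LHS]mx11_scalar -/(dotv v v) dotvv v_unit.
  have := char_poly_deflation Av vv1; rewrite char_polyA !big_cons subr0 mulrCA.
  by move/mulfI => -> //; rewrite polyXsubC_eq0.
have : root (char_poly T) mu.
  rewrite -eigenvalue_root_char; apply/eigenvalueP; exists u^T.
    by rewrite -symT -trmx_mul Tu linearZ.
  by rewrite trmx_eq0 -sqnorm_gt0 u_unit ltr01.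
rewrite char_polyT root_prod_XsubC inE => /orP[/eqP -> //|/gap].
exact: le_trans (ler_norm _).
Qed.

(** * Products of independent Bernoulli variables *)

Lemma prod_exp_count (R : comNzRingType) (E : finType) (F : E -> R) (s : seq E) :
  \prod_(e <- s) F e = \prod_e F e ^+ count_mem e s.
Proof.
rewrite -prodr_undup_exp_count big_uniq ?undup_uniq // [LHS]big_mkcond /=.
by apply: eq_bigr => e _; rewrite mem_undup; case: ifPn => // /count_memPn ->.
Qed.

Section BernoulliProduct.
Variables (R : realType) (E : finType) (p : E -> R).
Hypothesis p01 : forall e, 0 <= p e <= 1.
Implicit Types (w : {ffun E -> bool}) (s : seq E) (q r : R).

Definition bernoulli_mass q (a : bool) : R := if a then q else 1 - q.

Definition product_mass w : R := \prod_e bernoulli_mass (p e) (w e).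

Definition mean (f : {ffun E -> bool} -> R) : R := \sum_w product_mass w * f w.

Definition centred w e : R := (w e)%:R - p e.

Definition central_moment k q : R := \sum_a bernoulli_mass q a * (a%:R - q) ^+ k.

Lemma product_mass_ge0 w : 0 <= product_mass w.
Proof. by apply: prodr_ge0 => e _; have := p01 e; case: (w e) => /=; lra. Qed.

Lemma ler_mean (f g : {ffun E -> bool} -> R) :
  (forall w, f w <= g w) -> mean f <= mean g.
Proof. by move=> le_fg; apply: ler_sum => w _; rewrite ler_wpM2l ?product_mass_ge0. Qed.

Lemma mean_sum (I : finType) (f : I -> {ffun E -> bool} -> R) :
  mean (fun w => \sum_i f i w) = \sum_i mean (f i).
Proof. by rewrite exchange_big; apply: eq_bigr => w _; rewrite mulr_sumr. Qed.

Lemma mean_prod (f : E -> bool -> R) :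
  mean (fun w => \prod_e f e (w e)) = \prod_e \sum_a bernoulli_mass (p e) a * f e a.
Proof. by rewrite bigA_distr_bigA; apply: eq_bigr => w _; rewrite -big_split. Qed.

Lemma central_moment0 q : central_moment 0 q = 1.
Proof. by rewrite /central_moment big_bool /= !expr0 !mulr1 addrC subrK. Qed.

Lemma central_moment1 q : central_moment 1 q = 0.
Proof. by rewrite /central_moment big_bool /=; ring. Qed.

Lemma mean1 : mean (fun=> 1) = 1.
Proof.
rewrite /mean; under eq_bigr do rewrite mulr1.
rewrite -(bigA_distr_bigA (fun e => bernoulli_mass (p e))) big1 // => e _.
by rewrite big_bool /= addrC subrK.
Qed.

Lemma norm_central_moment_le q k : 0 <= q <= 1 -> (1 < k)%N ->
  `|central_moment k q| <= q.
Proof.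
move=> q01 k_gt1; rewrite /central_moment big_bool /= sub0r.
apply: le_trans (ler_normD _ _) _; rewrite !normrM !normrX normrN.
rewrite !ger0_norm ?subr_ge0; try lra.
have exp_le_sqr (y : R) : 0 <= y <= 1 -> y ^+ k <= y ^+ 2.
  by case/andP=> y0 y1; rewrite ler_wiXn2l.
have q'01 : 0 <= 1 - q <= 1 by lra.
have [q0 q'0] : 0 <= q /\ 0 <= 1 - q by lra.
have := ler_wpM2l q0 (exp_le_sqr _ q'01); have := ler_wpM2l q'0 (exp_le_sqr _ q01).
nra.
Qed.

Lemma mean_prod_centred s :
  mean (fun w => \prod_(e <- s) centred w e)
  = \prod_e central_moment (count_mem e s) (p e).
Proof.
rewrite -(mean_prod (fun e a => (a%:R - p e) ^+ count_mem e s)).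
by apply: eq_bigr => w _; rewrite prod_exp_count.
Qed.

Definition support_weight r s : R := \prod_(e <- undup s) (p e / r ^+ 2).

Lemma support_weight_ge0 r s : 0 <= support_weight r s.
Proof.
by apply: prodr_ge0 => e _; rewrite divr_ge0 ?sqr_ge0 //; case/andP: (p01 e).
Qed.

Lemma norm_mean_prod_centred_le r s : 1 <= r ->
  `|mean (fun w => \prod_(e <- s) centred w e)| <= r ^+ size s * support_weight r s.
Proof.
move=> r1; have r0 : 0 < r by lra.
have -> : r ^+ size s = \prod_(e <- s) r.
  by rewrite big_const_seq count_predT iter_mulr_1.
rewrite prod_exp_count /support_weight (big_uniq _ (undup_uniq s)).
rewrite [X in _ * X]big_mkcond /=.
rewrite mean_prod_centred normr_prod -big_split /=; apply: ler_prod => e _.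
rewrite normr_ge0 mem_undup -has_pred1 has_count.
case: (count_mem e s) => [|[|k]] /=.
- by rewrite central_moment0 normr1 expr0 mulr1.
- have /andP[p0 _] := p01 e.
  by rewrite central_moment1 normr0 mulr_ge0 ?divr_ge0 ?exprn_ge0 // ltW.
apply: le_trans (norm_central_moment_le (p01 e) (isT : 1 < k.+2)%N) _.
rewrite -[k.+2]addn2 exprD -mulrA [r ^+ 2 * _]mulrC divfK ?expf_neq0 ?gt_eqF //.
by rewrite ler_peMl ?exprn_ege1 //; case/andP: (p01 e).
Qed.

Lemma sum_support_weight_cons_le (I : finType) (f : I -> E) r s : injective f ->
  \sum_i support_weight r (f i :: s)
    <= ((size s)%:R + (\sum_i p (f i)) / r ^+ 2) * support_weight r s.
Proof.
move=> f_inj; apply: (@le_trans _ _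
  (\sum_i ((f i \in s)%:R + p (f i) / r ^+ 2) * support_weight r s)).
  apply: ler_sum => i _; rewrite /support_weight /=.
  have weight0 : 0 <= p (f i) / r ^+ 2.
    by rewrite divr_ge0 ?sqr_ge0 //; case/andP: (p01 (f i)).
  case: ifP => _; first by rewrite ler_peMl ?support_weight_ge0 // lerDl.
  by rewrite big_cons add0r.
rewrite -mulr_suml ler_wpM2r ?support_weight_ge0 // big_split /= -mulr_suml lerD2r.
rewrite -natr_sum ler_nat -big_mkcond /= sum1_card -(size_image f).
apply: uniq_leq_size; first by rewrite map_inj_uniq ?enum_uniq.
by move=> e /fintype.imageP[i fis ->].
Qed.

End BernoulliProduct.

(** * Trace moments of the centred adjacency matrix *)

Section GraphMoments.
Variables (R : realType) (n : nat) (Abar : 'M[R]_n).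
Hypothesis Abar_prob : edge_prob_matrix Abar.
Implicit Types (w : outcome n) (s : seq ('I_n * 'I_n)) (r : R).

Definition edge_prob (e : 'I_n * 'I_n) : R :=
  if (e.1 <= e.2)%N then Abar e.1 e.2 else 0.

Definition edge (x y : 'I_n) : 'I_n * 'I_n :=
  if (x <= y)%N then (x, y) else (y, x).

Lemma edge_inj x : injective (edge x).
Proof.
move=> y z; rewrite /edge; case: leqP => _; case: leqP => _ [] //.
- by move=> <- ->.
- by move=> -> <-.
Qed.

Lemma edge_prob_edge x y : edge_prob (edge x y) = Abar x y.
Proof.
rewrite /edge_prob /edge; case: (leqP x y) => /= [-> //|/ltnW ->].
by rewrite -[in LHS]Abar_prob.1 mxE.
Qed.

Lemma edge_prob01 e : 0 <= edge_prob e <= 1.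
Proof. by rewrite /edge_prob; case: ifP => _; rewrite ?Abar_prob.2 ?lexx ?ler01. Qed.

Lemma outcome_weightE w : outcome_weight Abar w = product_mass edge_prob w.
Proof.
apply: eq_bigr => e _; rewrite /edge_prob /bernoulli_mass.
by case: ifP => _; case: (w e); rewrite ?subr0.
Qed.

Lemma adjmx_sym w : (adjmx R w)^T = adjmx R w.
Proof.
apply/matrixP => i j; rewrite !mxE; case: (ltngtP i j) => //= ij.
by rewrite (val_inj ij).
Qed.

Lemma adjmx_subE w x y : (adjmx R w - Abar) x y = centred edge_prob w (edge x y).
Proof. by rewrite !mxE /centred edge_prob_edge -/(edge x y); case: (w _). Qed.

Lemma dmax_ge0 : 0 <= dmax Abar.
Proof. exact: bigmax_ge_id. Qed.

Lemma degree_le_dmax x : \sum_y Abar x y <= dmax Abar.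
Proof. exact: (le_bigmax _ (fun x => \sum_y Abar x y)). Qed.

Lemma sum_support_weight_edge_le r s x :
  \sum_y support_weight edge_prob r (edge x y :: s)
    <= ((size s)%:R + dmax Abar / r ^+ 2) * support_weight edge_prob r s.
Proof.
apply: le_trans (sum_support_weight_cons_le edge_prob01 r s (@edge_inj x)) _.
under eq_bigr do rewrite edge_prob_edge.
rewrite ler_wpM2r ?support_weight_ge0 //; first exact: edge_prob01.
by rewrite lerD2l ler_wpM2r ?invr_ge0 ?sqr_ge0 ?degree_le_dmax.
Qed.

(* The part of the expansion of [(adjmx w - Abar) ^+ (size s + m)] given by the walks
   that have traversed [s], are at [x], and reach [z] in [m] further steps. *)
Definition walk_sum s m x z w : R :=
  (\prod_(e <- s) centred edge_prob w e) * ((adjmx R w - Abar) ^+ m) x z.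

Lemma walk_sumS s m x z w :
  walk_sum s m.+1 x z w = \sum_y walk_sum (edge x y :: s) m y z w.
Proof.
rewrite /walk_sum exprS mxE mulr_sumr; apply: eq_bigr => y _.
by rewrite big_cons adjmx_subE; ring.
Qed.

Lemma mean_walk_sum_le r N s m x z : 1 <= r -> (size s + m <= N)%N ->
  mean edge_prob (walk_sum s m x z)
  <= r ^+ size s * support_weight edge_prob r s
     * (r * (N%:R + dmax Abar / r ^+ 2)) ^+ m.
Proof.
move=> r1; have r0 : 0 <= r by lra.
elim: m s x => [|m IH] s x sN.
  have centred_le := norm_mean_prod_centred_le edge_prob01 s r1.
  rewrite expr0 mulr1 /walk_sum; under [X in mean _ X]eq_fun do rewrite expr0 mxE.
  case: eqP => _.
    under [X in mean _ X]eq_fun do rewrite mulr1.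
    exact: le_trans (ler_norm _) centred_le.
  rewrite /mean big1 => [|w _]; last by rewrite !mulr0.
  exact: le_trans (normr_ge0 _) centred_le.
set K := N%:R + _.
have K0 : 0 <= K by rewrite addr_ge0 ?divr_ge0 ?dmax_ge0 ?sqr_ge0.
have -> : mean edge_prob (walk_sum s m.+1 x z)
    = \sum_y mean edge_prob (walk_sum (edge x y :: s) m y z).
  by rewrite -mean_sum; congr mean; apply/funext => w; exact: walk_sumS.
apply: (@le_trans _ _ (\sum_y r ^+ (size s).+1
    * support_weight edge_prob r (edge x y :: s) * (r * K) ^+ m)).
  by apply: ler_sum => y _; apply: IH; rewrite /= addSnnS.
have next_edge_le : \sum_y support_weight edge_prob r (edge x y :: s)
    <= K * support_weight edge_prob r s.
  apply: le_trans (sum_support_weight_edge_le _ _ _) _.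
  rewrite ler_wpM2r ?(support_weight_ge0 edge_prob01) //.
  by rewrite lerD2r ler_nat (leq_trans _ sN) ?leq_addr.
have -> : r ^+ size s * support_weight edge_prob r s * (r * K) ^+ m.+1
    = r ^+ (size s).+1 * (K * support_weight edge_prob r s) * (r * K) ^+ m.
  by rewrite !exprS; ring.
by rewrite -mulr_suml -mulr_sumr ler_wpM2r ?ler_wpM2l ?exprn_ge0 // mulr_ge0.
Qed.

Lemma mean_trace_le r m : 1 <= r ->
  mean edge_prob (fun w => \tr ((adjmx R w - Abar) ^+ m))
  <= n%:R * (m%:R * r + dmax Abar / r) ^+ m.
Proof.
move=> r1; have r_neq0 : r != 0 by rewrite gt_eqF //; lra.
rewrite mean_sum mulr_natl -[X in _ *+ X]card_ord -sumr_const; apply: ler_sum => x _.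
have := mean_walk_sum_le x x r1 (leqnn (size [::] + m)).
rewrite /support_weight !big_nil expr0 !mul1r.
have -> : r * (m%:R + dmax Abar / r ^+ 2) = m%:R * r + dmax Abar / r by field.
apply: le_trans; apply: ler_mean => [|w]; first exact: edge_prob01.
by rewrite /walk_sum big_nil mul1r.
Qed.

Lemma ler_prob_graph (P Q : 'M[R]_n -> Prop) :
  (forall w, P (adjmx R w) -> Q (adjmx R w)) -> prob_graph Abar P <= prob_graph Abar Q.
Proof.
move=> PQ; rewrite /prob_graph big_mkcond [leRHS]big_mkcond; apply: ler_sum => w _.
have weight0 : 0 <= outcome_weight Abar w.
  by rewrite outcome_weightE product_mass_ge0 //; exact: edge_prob01.
case: asboolP => [/PQ Qw|_]; first by rewrite asboolT.
by case: ifP.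
Qed.

Lemma prob_graph_markov (f : 'M[R]_n -> R) (t delta : R) :
  0 < t -> (forall w, 0 <= f (adjmx R w)) ->
  mean edge_prob (fun w => f (adjmx R w)) <= delta * t ->
  1 - delta <= prob_graph Abar (fun A => f A <= t).
Proof.
move=> t0 f0 mean_le; rewrite -(ler_pM2r t0) mulrBl mul1r.
apply: le_trans (lerB (lexx t) mean_le) _.
rewrite lerBlDr -{1}[t]mulr1 -(mean1 edge_prob).
rewrite /prob_graph big_mkcond mulr_suml mulr_sumr -big_split /=; apply: ler_sum => w _.
have weight0 := product_mass_ge0 edge_prob01 w.
rewrite outcome_weightE mulr1 mulrC; case: asboolP => [_|/negP].
  by rewrite lerDl mulr_ge0.
by rewrite -ltNge mul0r add0r => /ltW; exact: ler_wpM2l.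
Qed.

End GraphMoments.

(** * Concentration of the numerical radius *)

Section ScalarEstimates.
Variable R : realType.
Implicit Types x L : R.

Lemma expR_half_le2 : expR 2^-1 <= 2 :> R.
Proof.
have := expR_ge1Dx (- 2^-1 : R); rewrite expRN => half_le.
rewrite -[leRHS]invrK -[leLHS]invrK lef_pV2 ?posrE ?invr_gt0 ?expR_gt0 //.
by apply: le_trans half_le; lra.
Qed.

Lemma expR_le_exp2 L m : 2 * L <= m%:R -> expR L <= 2 ^+ m.
Proof.
move=> L_le; apply: (@le_trans _ _ (expR 2^-1 ^+ m)).
  by rewrite -expRM_natl ler_expR; lra.
by rewrite lerXn2r ?nnegrE ?expR_ge0 ?expR_half_le2.
Qed.

Lemma ln_ge_half x : 2 <= x -> 2^-1 <= ln x.
Proof.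
by move=> x2; rewrite -ler_expR lnK ?posrE; [exact: le_trans expR_half_le2 x2 | lra].
Qed.

Lemma exists_expn2_between x : 1 <= x ->
  exists k, x <= (2 ^ k.+1)%:R <= 2 * x.
Proof.
move=> x1; have x0 : 0 <= x by lra.
exists (trunc_log 2 (Num.truncn x)); apply/andP; split.
  by apply: le_trans (ltW (truncnS_gt x)) _; rewrite ler_nat trunc_log_ltn.
rewrite expnS natrM ler_pM2l // -truncn_ge_nat // trunc_logP //.
by rewrite truncn_gt0.
Qed.

End ScalarEstimates.

Section NumericalRadius.
Variables (R : realType) (n : nat).
Implicit Types (A B Abar : 'M[R]_n) (eta L delta : R).

Definition numerical_radius_le B eta := forall x, sqnorm x = 1 -> `|qform B x| <= eta.

Lemma numerical_radius_le_trace B eta k : B^T = B -> 0 <= eta ->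
  \tr (B ^+ (2 ^ k.+1)) <= eta ^+ (2 ^ k.+1) -> numerical_radius_le B eta.
Proof.
move=> symB eta0 le_tr x x1.
rewrite -(@ler_pXn2r _ (2 ^ k.+1)) ?nnegrE ?expn_gt0 //.
apply: le_trans le_tr; apply: le_trans (qform_expn2_le_trace k symB x1).
by rewrite -normrX expnS exprM ger0_norm // exprn_ge0 // sqr_ge0.
Qed.

(* The parameter [r = 3 d / (2 S)] with [S = sqrt (d L)] is admissible, i.e. at
   least [1], precisely when [4 / 9 * L <= d]. *)
Lemma mean_trace_le_sqrt Abar L m :
  edge_prob_matrix Abar -> 0 < L -> 4 / 9 * L <= dmax Abar -> m%:R <= 4 * L ->
  mean (edge_prob Abar) (fun w => \tr ((adjmx R w - Abar) ^+ m))
  <= n%:R * (7 * Num.sqrt (dmax Abar * L)) ^+ m.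
Proof.
move=> Abar_prob L0 L_le m_le; set d := dmax Abar in L_le *; set S := Num.sqrt _.
have d0 : 0 < d by lra.
have S0 : 0 < S by rewrite sqrtr_gt0 mulr_gt0.
have S2 : S ^+ 2 = d * L by rewrite sqr_sqrtr // mulr_ge0 // ltW.
pose r := 3 / 2 * d / S.
have r1 : 1 <= r.
  rewrite ler_pdivlMr // mul1r -(@ler_pXn2r _ 2) ?nnegrE ?(ltW S0) // ?S2; last by lra.
  by nra.
have rL : r * L = 3 / 2 * S.
  apply: (mulIf (lt0r_neq0 S0)); rewrite -[RHS]mulrA -expr2 S2 /r.
  by field; rewrite gt_eqF.
have d_div_r : d / r = 2 / 3 * S by rewrite /r; field; rewrite !gt_eqF.
have r0 : 0 <= r by lra.
apply: le_trans (mean_trace_le Abar_prob m r1) _; rewrite ler_wpM2l //.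
have m_r : m%:R * r <= 6 * S by have := ler_wpM2r r0 m_le; lra.
have mr0 : 0 <= m%:R * r by rewrite mulr_ge0.
by rewrite -/d d_div_r lerXn2r ?nnegrE //; lra.
Qed.

Lemma prob_graph_numerical_radius Abar delta :
  let L := ln (2 * n%:R / delta) in
  edge_prob_matrix Abar -> (0 < n)%N -> 0 < delta < 1 -> 4 / 9 * L <= dmax Abar ->
  1 - delta <= prob_graph Abar (fun A =>
    numerical_radius_le (A - Abar) (14 * Num.sqrt (dmax Abar * L))).
Proof.
move=> L Abar_prob n_gt0 /andP[delta0 delta1] L_le.
have n1 : 1 <= n%:R :> R by rewrite ler1n.
have ratio2 : 2 <= 2 * n%:R / delta by rewrite ler_pdivlMr //; nra.
have L_half : 2^-1 <= L by exact: ln_ge_half.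
have expL : expR L = 2 * n%:R / delta by rewrite lnK // posrE; lra.
set S := Num.sqrt _; have S0 : 0 < S by rewrite sqrtr_gt0 mulr_gt0 //; lra.
have [|k /andP[m_ge m_le]] := @exists_expn2_between _ (2 * L); first lra.
set m := (2 ^ k.+1)%N in m_ge m_le.
have symB w : (adjmx R w - Abar)^T = adjmx R w - Abar.
  by rewrite linearB /= adjmx_sym Abar_prob.1.
apply: (@le_trans _ _
  (prob_graph Abar (fun A => \tr ((A - Abar) ^+ m) <= (14 * S) ^+ m))).
  apply: prob_graph_markov => //.
  - by rewrite exprn_gt0 // mulr_gt0.
  - by move=> w; rewrite /m expnS mul2n mxtrace_exp_double_ge0.
  have m_le4 : m%:R <= 4 * L by lra.
  apply: le_trans (mean_trace_le_sqrt Abar_prob _ L_le m_le4) _; first lra.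
  have -> : (14 * S) ^+ m = 2 ^+ m * (7 * S) ^+ m.
    by rewrite -exprMn; congr (_ ^+ _); ring.
  rewrite mulrA ler_wpM2r ?exprn_ge0 ?mulr_ge0 ?(ltW S0) //.
  have := expR_le_exp2 m_ge; rewrite expL ler_pdivrMr // => n_le.
  by rewrite [leRHS]mulrC; lra.
apply: ler_prob_graph => // w; apply: numerical_radius_le_trace => //.
by rewrite mulr_ge0 // ltW.
Qed.

End NumericalRadius.

(** * Alignment of the top eigenvectors *)

Section Alignment.
Variables (R : realType) (n : nat) (Abar A : 'M[R]_n) (lam mu : R) (v u : 'cV[R]_n).
Hypotheses (Abar_sym : Abar^T = Abar) (v_unit : sqnorm v = 1).
Hypothesis Abar_v : Abar *m v = lam *: v.
Hypothesis A_top : principal_eigenpair A mu u.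

(* Both top vectors are tested against both matrices; the component of [u]
   orthogonal to [v] has squared norm [1 - dotv u v ^+ 2]. *)
Lemma principal_eigenvector_alignment kappa eta :
  0 <= kappa * lam -> inv_spectral_gap_le Abar lam kappa ->
  numerical_radius_le (A - Abar) eta ->
  (1 - dotv u v ^+ 2) * ((1 - kappa) * lam) <= 2 * eta.
Proof.
move=> klam0 gap radius_le; have [u_unit Au le_mu] := A_top.
pose c := dotv u v; pose w := u - c *: v.
have vw : dotv v w = 0 by rewrite linearBr linearZr /= dotvv v_unit mulr1 dotvC subrr.
have uE : u = c *: v + w by rewrite addrC subrK.
clearbody w.
have w_norm : sqnorm w = 1 - c ^+ 2.
  have := u_unit; rewrite {1}uE sqnormD sqnormZ v_unit [dotv _ w]linearZl /= vw => <-.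
  by ring.
have v_form : qform Abar v = lam.
  by rewrite /qform Abar_v linearZr /= dotvv v_unit mulr1.
have cross0 : dotv (c *: v) (Abar *m w) = 0.
  by rewrite linearZl /= dotv_mulmx Abar_sym Abar_v [dotv _ w]linearZl /= vw !mulr0.
have u_form : qform Abar u = c ^+ 2 * lam + qform Abar w.
  by rewrite {1}uE qformD // qformZ v_form cross0 mulr0 addr0.
have w_form_le : qform Abar w <= kappa * lam * (1 - c ^+ 2).
  by rewrite -w_norm; exact: qform_orthogonal_le vw.
have u_formA : qform A u = mu by rewrite /qform Au linearZr /= dotvv u_unit mulr1.
have := radius_le v v_unit; have := radius_le u u_unit; have := le_mu v.
rewrite !qformB u_formA v_form u_form v_unit !ler_norml -/c.
by move=> v_le /andP[_ u_le] /andP[v_ge _]; lra.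
Qed.

Lemma concentration_alignment eps delta : 0 < eps < 1 -> 0 < delta < 1 ->
  concentration Abar lam eps delta ->
  numerical_radius_le (A - Abar)
    (14 * Num.sqrt (dmax Abar * ln (2 * n%:R / delta))) ->
  1 - eps < dotv u v ^+ 2.
Proof.
move=> /andP[eps0 eps1] /andP[delta0 delta1] [L_le [kappa [kappa0 [kappa1 [gap]]]]].
have n1 : 1 <= n%:R :> R by rewrite ler1n (unit_vector_dim_gt0 v_unit).
have L_gt0 : 0 < ln (2 * n%:R / delta) by rewrite ln_gt0 // ltr_pdivlMr //; lra.
set S := Num.sqrt _ => lam_ge radius_le.
have S0 : 0 < S by rewrite sqrtr_gt0 mulr_gt0 //; lra.
rewrite ler_pdivrMr ?exprn_gt0 // in lam_ge.
have gap0 : 0 < lam * (1 - kappa ^+ 2).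
  rewrite -(pmulr_lgt0 _ (exprn_gt0 2 eps0)).
  by apply: lt_le_trans lam_ge; rewrite mulr_gt0.
have lam0 : 0 < lam by move: gap0; rewrite pmulr_lgt0 // subr_gt0 expr_lt1.
have := principal_eigenvector_alignment (mulr_ge0 kappa0 (ltW lam0)) gap radius_le.
set c2 := _ ^+ 2 => align; rewrite ltNge; apply/negP => c2_le.
have eps_gap : eps * (lam * (1 - kappa ^+ 2)) <= 56 * S.
  have misaligned : eps * ((1 - kappa) * lam) <= 28 * S.
    apply: le_trans (_ : _ <= 2 * (14 * S)) _; last lra.
    by apply: le_trans align; rewrite ler_wpM2r ?mulr_ge0 ?(ltW lam0) //; lra.
  have : eps * ((1 - kappa) * lam) * (1 + kappa) <= 28 * S * 2.
    by apply: ler_pM; rewrite ?mulr_ge0 ?(ltW eps0) ?(ltW lam0) //; lra.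
  by lra.
have := ler_wpM2l (ltW eps0) eps_gap; nra.
Qed.

End Alignment.

(** * Welfare of an intervention *)

Section CoerciveMatrix.
Variables (R : realType) (n : nat) (M : 'M[R]_n) (g : R).
Hypotheses (g0 : 0 < g) (coercive : forall z, g * sqnorm z <= qform M z).

Lemma coercive_unitmx : M \in unitmx.
Proof.
rewrite -row_free_unit; apply: inj_row_free => z zM.
have : g * sqnorm z^T <= 0.
  by apply: le_trans (coercive _) _; rewrite /qform /dotv trmxK mulmxA zM mul0mx mxE.
by rewrite pmulr_rle0 // leNgt sqnorm_gt0 negbK trmx_eq0 => /eqP.
Qed.

Lemma sqnorm_invmx_le x : g ^+ 2 * sqnorm (invmx M *m x) <= sqnorm x.
Proof.
set z := invmx M *m x; have Mz : M *m z = x by rewrite mulKVmx ?coercive_unitmx.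
have [->|z0] := eqVneq z 0; first by rewrite sqnorm0 mulr0 sqnorm_ge0.
rewrite -(ler_pM2r (_ : 0 < sqnorm z)) ?sqnorm_gt0 //.
apply: le_trans (_ : qform M z ^+ 2 <= _).
  have norm0 : 0 <= g * sqnorm z by rewrite mulr_ge0 ?sqnorm_ge0 // ltW.
  rewrite -mulrA -expr2 -exprMn lerXn2r ?nnegrE ?coercive //.
  exact: le_trans norm0 (coercive z).
by rewrite mulrC /qform Mz cauchy_schwarz.
Qed.

End CoerciveMatrix.

Lemma dotv_eigenvector_invmx (R : comUnitRingType) n (M : 'M[R]_n) (g : R)
    (u x : 'cV[R]_n) :
  M \in unitmx -> M^T = M -> M *m u = g *: u ->
  dotv u x = g * dotv u (invmx M *m x).
Proof.
move=> M_unit symM Mu.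
by rewrite -[in LHS](mulKVmx M_unit x) dotv_mulmx symM Mu linearZl.
Qed.

Section Welfare.
Variables (R : realType) (n : nat) (beta mu : R) (A : 'M[R]_n) (b u : 'cV[R]_n).
Hypotheses (A_sym : A^T = A) (A_top : principal_eigenpair A mu u).
Hypotheses (beta0 : 0 < beta) (stable : beta * mu < 1).
Implicit Types (v y ystar : 'cV[R]_n) (s : R).

Let g := 1 - beta * mu.
Let g0 : 0 < g. Proof. by rewrite subr_gt0. Qed.

Lemma Mgame_coercive z : g * sqnorm z <= qform (Mgame beta A) z.
Proof.
rewrite qformB qform1 [qform (_ *: _) _]/qform -scalemxAl linearZr /= -/(qform A z).
have [_ _ /(_ z) /(ler_wpM2l (ltW beta0))] := A_top.
by rewrite /g; lra.
Qed.

Lemma welfare_le_sqnorm y : 2 * g ^+ 2 * welfare beta A b y <= sqnorm (b + y).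
Proof.
by have := sqnorm_invmx_le g0 Mgame_coercive (b + y); rewrite /welfare; lra.
Qed.

Lemma sqr_dotv_le_welfare y : dotv u (b + y) ^+ 2 <= 2 * g ^+ 2 * welfare beta A b y.
Proof.
have [u_unit Au _] := A_top; set M := Mgame beta A.
have symM : M^T = M by rewrite linearB linearZ /= trmx1 A_sym.
have Mu : M *m u = g *: u.
  by rewrite mulmxBl mul1mx -scalemxAl Au scalerA scalerBl scale1r.
have M_unit : M \in unitmx := coercive_unitmx g0 Mgame_coercive.
rewrite (dotv_eigenvector_invmx _ M_unit symM Mu) exprMn.
have := cauchy_schwarz u (invmx M *m (b + y)); rewrite u_unit mul1r.
by move/(ler_wpM2l (sqr_ge0 g)); rewrite /welfare -/M; lra.
Qed.

Lemma competitive_ratio_ge s y ystar : 0 <= s ->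
  welfare beta A b y <= welfare beta A b ystar ->
  s * vnorm (b + ystar) < `|dotv u (b + y)| ->
  s ^+ 2 <= competitive_ratio beta A b y ystar.
Proof.
move=> s0 y_le lt_dotv; have gg0 : 0 < 2 * g ^+ 2 by rewrite mulr_gt0 ?exprn_gt0.
have sqr_lt : s ^+ 2 * sqnorm (b + ystar) < 2 * g ^+ 2 * welfare beta A b y.
  apply: lt_le_trans (sqr_dotv_le_welfare y); rewrite -sqr_vnorm -exprMn.
  by rewrite -[ltRHS]real_normK ?num_real // ltrXn2r ?mulr_ge0 ?vnorm_ge0.
have y0 : 0 < welfare beta A b y.
  rewrite -(pmulr_rgt0 _ gg0); apply: le_lt_trans sqr_lt.
  by rewrite mulr_ge0 ?sqr_ge0 ?sqnorm_ge0.
rewrite ler_pdivlMr ?(lt_le_trans y0) // -(ler_pM2l gg0) mulrCA.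
apply: le_trans (ltW sqr_lt); rewrite ler_wpM2l ?sqr_ge0 //; exact: welfare_le_sqnorm.
Qed.

Lemma competitive_ratio_large_budget eps v : sqnorm v = 1 -> eps < 1 ->
  1 - eps < dotv u v ^+ 2 ->
  exists C0 : R, forall C : R, C0 <= C ->
    forall ystar, optimal_intervention beta A b C ystar ->
      1 - eps <= competitive_ratio beta A b (Num.sqrt C *: v) ystar.
Proof.
move=> v_unit eps1 lt_c; have [u_unit _ _] := A_top.
pose c := `|dotv u v|; pose s := Num.sqrt (1 - eps).
have s0 : 0 <= s := sqrtr_ge0 _.
have s2 : s ^+ 2 = 1 - eps by rewrite sqr_sqrtr // subr_ge0 ltW.
have s_lt_c : 0 < c - s.
  by rewrite subr_gt0 -(@ltr_pXn2r _ 2) ?nnegrE ?normr_ge0 // s2 real_normK ?num_real.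
pose K := (1 + s) * vnorm b / (c - s) + 1.
have K0 : 0 <= K.
  by rewrite addr_ge0 // divr_ge0 ?(ltW s_lt_c) // mulr_ge0 ?vnorm_ge0 // addr_ge0.
exists (K ^+ 2) => C C_ge ystar [ystarC opt]; set q := Num.sqrt C in ystarC opt *.
have q0 : 0 <= q := sqrtr_ge0 _.
have q_ge : K <= q by rewrite -[K]ger0_norm // -sqrtr_sqr ler_wsqrtr.
have vnorm_qv : vnorm (q *: v) = q.
  by rewrite vnormZ ger0_norm // ((vnorm_eq1 v).2 v_unit) mulr1.
rewrite -s2; apply: competitive_ratio_ge => //; first exact: opt.
have dotv_ge : q * c - vnorm b <= `|dotv u (b + q *: v)|.
  have := dotv_le_vnorm u b; rewrite ((vnorm_eq1 u).2 u_unit) mul1r => b_le.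
  have := lerB_normD (q * dotv u v) (dotv u b).
  by rewrite normrM (ger0_norm q0) -/c linearDr linearZr /= (addrC (dotv u b)); lra.
have ystar_le : s * vnorm (b + ystar) <= s * (vnorm b + q).
  by rewrite ler_wpM2l // -ystarC ler_vnormD.
have KE : K * (c - s) = (1 + s) * vnorm b + (c - s).
  by rewrite mulrDl divfK ?gt_eqF // mul1r.
by have := ler_wpM2r (ltW s_lt_c) q_ge; rewrite KE; lra.
Qed.

End Welfare.

Theorem theorem1 (R : realType) (n : nat) (Abar : 'M[R]_n)
    (lam1 : R) (v1 : 'cV[R]_n) (eps delta beta : R) (b : 'cV[R]_n) :
  edge_prob_matrix Abar ->
  top_eigenpair Abar lam1 v1 ->
  0 < eps < 1 -> 0 < delta < 1 ->
  concentration Abar lam1 eps delta ->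
  0 < beta ->
  (forall i, 0 <= b i 0) ->
  prob_graph Abar (fun A =>
    spectral_radius_lt A (1 / beta) ->
    exists C0 : R, forall C : R, C0 <= C ->
      forall ystar : 'cV[R]_n, optimal_intervention beta A b C ystar ->
        competitive_ratio beta A b (Num.sqrt C *: v1) ystar >= 1 - eps)
  >= 1 - delta.
Proof.
move=> Abar_prob [Abar_v1 [/vnorm_eq1 v1_unit _]] /[dup] eps01 /andP[_ eps1].
move=> delta01 conc beta0 _; have n_gt0 := unit_vector_dim_gt0 v1_unit.
apply: le_trans (prob_graph_numerical_radius Abar_prob n_gt0 delta01 conc.1) _.
apply: ler_prob_graph => // w radius_le stable.
have symA := adjmx_sym R w.
have [mu [u A_top]] := exists_principal_eigenpair n_gt0 symA.
have aligned : 1 - eps < dotv u v1 ^+ 2.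
  exact: (concentration_alignment Abar_prob.1 v1_unit Abar_v1 A_top eps01 delta01 conc).
have beta_mu : beta * mu < 1.
  have [u_unit Au _] := A_top; have u0 : u != 0 by rewrite -sqnorm_gt0 u_unit.
  by have := le_lt_trans (ler_norm _) (stable mu u u0 Au); rewrite ltr_pdivlMr // mulrC.
exact: (competitive_ratio_large_budget b symA A_top beta0 beta_mu v1_unit eps1).
Qed.
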